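(* For every positive integer $r$ there is an integer $t_0(r)$ such that for all integers $t\ge t_0(r)$ there exists an $r$-$\mathrm{SFPC}(v,t)$ (an $r$-secure frameproof code of length $v$ and size $t$) for some $v$ with $$v\leq \frac{\binom{t}{\lceil t/2\rceil}}{2\binom{t-2r}{\lceil t/2\rceil-r}}\left(1+\ln\left(\binom{\lceil t/2\rceil}{r}\binom{\lfloor t/2\rfloor}{r}\right)\right).$$
   Context: A $(v,t)$-code is a set $\Gamma\subseteq\{0,1\}^v$ with $|\Gamma|=t$. For a nonempty $C\subseteq\Gamma$, a coordinate $i\in\{1,\ldots,v\}$ is undetectable for $C$ if all words of $C$ have the same $i$th component; $U(C)$ is the set of undetectable coordinates for $C$, and $F(C)=\{x\in\{0,1\}^v : x|_{U(C)}=w|_{U(C)}\text{ for all } w\in C\}$. The code $\Gamma$ is an $r$-secure frameproof code, written $r$-$\mathrm{SFPC}(v,t)$, if for all nonempty $C_1,C_2\subseteq\Gamma$ with $|C_1|\le r$, $|C_2|\le r$ and $C_1\cap C_2=\varnothing$, one has $F(C_1)\cap F(C_2)=\varnothing$. *)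

(* Defs.v *)
From mathcomp Require Import all_boot.

Set Implicit Arguments.
Unset Strict Implicit.
Unset Printing Implicit Defensive.

Definition word (v : nat) := {ffun 'I_v -> bool}.

(* U(C) *)
Definition undetectable (v : nat) (C : {set word v}) : {set 'I_v} :=
  [set i | [forall x : word v in C, forall y : word v in C, x i == y i]].

(* F(C); the equality of restrictions x|_U(C) = w|_U(C) is spelled pointwise. *)
Definition feasible (v : nat) (C : {set word v}) : {set word v} :=
  [set x : word v |
    [forall w : word v in C, forall i in undetectable C, x i == w i]].

Definition secure_frameproof (v r : nat) (G : {set word v}) : Prop :=
  forall C1 C2 : {set word v},
    C1 != set0 -> C2 != set0 ->
    C1 \subset G -> C2 \subset G ->
    #|C1| <= r -> #|C2| <= r ->
    C1 :&: C2 = set0 ->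
    feasible C1 :&: feasible C2 = set0.

(* r-SFPC(v,t) *)
Definition SFPC (r v t : nat) (G : {set word v}) : Prop :=
  #|G| = t /\ secure_frameproof r G.

Arguments SFPC : clear implicits.

(* Main.v *)
Require Import Defs.
From mathcomp Require Import all_boot all_order all_algebra.
From mathcomp Require Import reals exp.
From mathcomp Require Import zify lra.

Set Implicit Arguments.
Unset Strict Implicit.

Import Order.TTheory GRing.Theory Num.Theory.
Local Open Scope ring_scope.

(** An r-secure frameproof code of size [t >= 2 * r] amounts to a family of
    bipartitions of a [t]-set of users, one per coordinate, such that any two
    disjoint [r]-subsets of users lie on opposite sides of some bipartition: at
    that coordinate two disjoint coalitions see constant, opposite values, so
    no word is feasible for both, and enlarging coalitions to exactly [r] users
    only makes them harder to separate ([separating_family_SFPC]).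

    Take as candidates the subsets [A] of size [uphalf t], and as points to be
    covered the unordered pairs of disjoint [r]-sets. One [A] separates at most
    [d = 'C(uphalf t, r) * 'C(t./2, r)] pairs ([card_separated_pairs_le]), while
    a given pair is separated by at least [a = 2 * 'C(t - 2 * r, uphalf t - r)]
    sets, the factor 2 counting the two orientations
    ([separating_sets_lower_bound]). By the Stein-Lovasz theorem
    ([Stein_Lovasz]) a greedy choice covers all pairs using at most
    ['C(t, uphalf t) / a * (1 + ln d)] sets, which is the bound.

    The Stein-Lovasz theorem is proved with the potential
    [\sum_A lnpot (number of uncovered pairs separated by A)], where [lnpot x]
    is [1 + ln x], or 0 for [x = 0]. Every greedy step decreases it by at least
    [a], and it starts at most at ['C(t, uphalf t) * (1 + ln d)]. *)

(** * The Stein-Lovasz covering theorem *)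

(** This stands in for the harmonic number [1 + 1/2 + ... + 1/x] of the
    classical greedy analysis, and gives the logarithmic bound directly. *)
Definition lnpot (R : realType) (x : nat) : R :=
  if x == 0%N then 0 else 1 + ln x%:R.

Lemma lnpot_ge0 (R : realType) (x : nat) : 0 <= lnpot R x.
Proof.
rewrite /lnpot; case: eqP => // /eqP x0.
by rewrite addr_ge0 // ln_ge0 // ler1n lt0n.
Qed.

Lemma lnpot_le (R : realType) (x d : nat) :
  (x <= d)%N -> lnpot R x <= 1 + ln d%:R.
Proof.
move=> xd; rewrite /lnpot; case: eqP => [_|/eqP x0].
  case: (posnP d) => [->|d0]; first by rewrite ln0 // addr0.
  by rewrite addr_ge0 // ln_ge0 // ler1n.
rewrite lerD2l ler_ln ?ler_nat // posrE ltr0n; lia.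
Qed.

(** For [0 < y] this is [ln z <= z - 1] at [z = y / x]; the summand 1 in
    [lnpot] is what makes it true for [y = 0]. *)
Lemma lnpot_drop (R : realType) (x y j : nat) :
  (y <= x)%N -> (x <= j)%N ->
  (x - y)%:R / j%:R <= lnpot R x - lnpot R y.
Proof.
move=> yx xj.
have [x0|x0] := posnP x.
  have -> : y = 0%N by lia.
  by rewrite x0 subnn mul0r subrr.
have xR : (0 : R) < x%:R by rewrite ltr0n.
have jR : (0 : R) < j%:R by rewrite ltr0n; lia.
apply: (@le_trans _ _ ((x - y)%:R / x%:R)).
  by rewrite ler_wpM2l // lef_pV2 ?posrE // ler_nat.
rewrite natrB // mulrBl divff ?gt_eqF //.
rewrite /lnpot (gtn_eqF x0); have [->|y0] := posnP y.
  by rewrite mul0r !subr0 lerDl ln_ge0 // ler1n.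
have yR : (0 : R) < y%:R by rewrite ltr0n.
have := @le_ln1Dx R (y%:R / x%:R - 1).
rewrite addrCA subrr addr0 ln_div ?posrE //.
have : 0 < y%:R / x%:R :> R by rewrite divr_gt0.
by move=> h /(_ ltac:(lra)); lra.
Qed.

(** One greedy step. Covering with a set [F i0] that meets [U] in the largest
    possible number [j] of points lowers each term of the potential by at least
    [#|U :&: F i :&: F i0| / j]. Summed over [i], this counts each of the [j]
    newly covered points at least [a] times. *)
Lemma greedy_step (R : realType) (I P : finType) (E : {set I})
    (F : I -> {set P}) (U : {set P}) (a : nat) (i0 : I) :
  (forall p, p \in U -> (a <= #|[set i in E | p \in F i]|)%N) ->
  (forall i, i \in E -> (#|U :&: F i| <= #|U :&: F i0|)%N) ->
  (0 < #|U :&: F i0|)%N ->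
  a%:R + \sum_(i in E) lnpot R #|(U :\: F i0) :&: F i|
    <= \sum_(i in E) lnpot R #|U :&: F i|.
Proof.
move=> degU maxi0 j0; rewrite -lerBrDr -sumrB.
set j := #|U :&: F i0|.
have jR : (0 : R) < j%:R by rewrite ltr0n.
apply: (@le_trans _ _ (\sum_(i in E) #|U :&: F i0 :&: F i|%:R / j%:R)).
  rewrite -mulr_suml -natr_sum ler_pdivlMr // -natrM ler_nat.
  (* double counting of the incidences between [E] and [U :&: F i0] *)
  have -> : (\sum_(i in E) #|U :&: F i0 :&: F i| =
      \sum_(p in U :&: F i0) #|[set i in E | p \in F i]|)%N.
    rewrite (eq_bigr (fun i => \sum_(p in U :&: F i0 | p \in F i) 1)%N).
      rewrite (exchange_big_dep (mem (U :&: F i0))) /=; last first.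
        by move=> i p _ /andP[].
      by apply: eq_bigr => p pU; rewrite -sum1_card; apply: eq_bigl => i;
        rewrite inE pU.
    by move=> i _; rewrite -sum1_card; apply: eq_bigl => p; rewrite inE.
  rewrite mulnC -sum_nat_const leq_sum // => p /setIP[pU _].
  exact: degU.
apply: ler_sum => i iE.
have -> : #|U :&: F i0 :&: F i| = (#|U :&: F i| - #|(U :\: F i0) :&: F i|)%N.
  by rewrite setIDAC cardsD subKn ?subset_leq_card ?subsetIl // setIAC.
by apply: lnpot_drop;
  [rewrite subset_leq_card // setSI // subsetDl|exact: maxi0].
Qed.

(** Some point of a nonempty [U] lies in some [F i] because [a > 0], so the
    greedy choice always makes progress. *)
Lemma greedy_cover (R : realType) (I P : finType) (E : {set I})
    (F : I -> {set P}) (U : {set P}) (a : nat) :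
  (0 < a)%N ->
  (forall p, p \in U -> (a <= #|[set i in E | p \in F i]|)%N) ->
  exists s : seq I,
    [/\ {subset s <= E},
        forall p, p \in U -> exists2 i, i \in s & p \in F i &
        (size s * a)%:R <= \sum_(i in E) lnpot R #|U :&: F i| ].
Proof.
move=> a0; have [n] := ubnP #|U|; elim: n U => // n IHn U leUn degU.
have [->|/set0Pn[p pU]] := eqVneq U set0.
  exists [::]; split=> // [p|]; first by rewrite inE.
  by rewrite mul0n sumr_ge0 // => i _; exact: lnpot_ge0.
have [i1 /setIdP[i1E pi1]] : exists i, i \in [set i in E | p \in F i].
  by apply/card_gt0P; apply: leq_trans a0 (degU p pU).
have [i0 i0E maxi0] := arg_maxnP (fun i => #|U :&: F i|) i1E.
have j0 : (0 < #|U :&: F i0|)%N.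
  apply: leq_trans (maxi0 _ i1E); apply/card_gt0P; exists p.
  by rewrite inE pU.
have [|q /setDP[qU _]|s [sE sU ks]] := IHn (U :\: F i0).
- by have := cardsID (F i0) U; lia.
- exact: degU.
exists (i0 :: s); split=> [i|q qU|].
- by rewrite inE => /predU1P[->//|/sE].
- have [qi0|qi0] := boolP (q \in F i0); first by exists i0; rewrite ?mem_head.
  have [|i si qi] := sU q; first by rewrite inE qi0.
  by exists i; rewrite // inE si orbT.
- apply: le_trans (greedy_step R degU maxi0 j0).
  by rewrite /= mulSn natrD lerD2l.
Qed.

Theorem Stein_Lovasz (R : realType) (I P : finType) (E : {set I})
    (F : I -> {set P}) (U : {set P}) (a d : nat) :
  (0 < a)%N ->
  (forall p, p \in U -> (a <= #|[set i in E | p \in F i]|)%N) ->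
  (forall i, i \in E -> (#|F i| <= d)%N) ->
  exists s : seq I,
    [/\ {subset s <= E},
        forall p, p \in U -> exists2 i, i \in s & p \in F i &
        (size s)%:R <= #|E|%:R / a%:R * (1 + ln d%:R) :> R ].
Proof.
move=> a0 degU cardF.
have [s [sE sU ks]] := greedy_cover R a0 degU.
exists s; split=> //.
rewrite mulrAC ler_pdivlMr ?ltr0n // -natrM (le_trans ks) //.
rewrite mulr_natl -sumr_const ler_sum // => i iE; apply: lnpot_le.
by apply: leq_trans (cardF i iE); rewrite subset_leq_card // subsetIr.
Qed.

(** * Codes from separating families of bipartitions *)

Definition separates (T : finType) (A C1 C2 : {set T}) : bool :=
  (C1 \subset A) && (C2 \subset ~: A) || (C2 \subset A) && (C1 \subset ~: A).

Definition separating_family (T : finType) (r : nat) (s : seq {set T}) : Prop :=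
  forall C1 C2 : {set T}, #|C1| = r -> #|C2| = r -> [disjoint C1 & C2] ->
    exists2 A, A \in s & separates A C1 C2.

Lemma separates_mem (T : finType) (A C1 C2 : {set T}) (x y : T) :
  separates A C1 C2 -> x \in C1 -> y \in C2 -> (x \in A) = (y \notin A).
Proof.
case/orP=> /andP[/subsetP s1 /subsetP s2] xC yC.
  by have := s2 y yC; rewrite inE (s1 x xC) => ->.
by have := s2 x xC; rewrite inE (s1 y yC) => /negbTE.
Qed.

Lemma separates_sub (T : finType) (A C1 C2 D1 D2 : {set T}) :
  C1 \subset D1 -> C2 \subset D2 -> separates A D1 D2 -> separates A C1 C2.
Proof.
move=> s1 s2 /orP[]/andP[h1 h2]; apply/orP; [left|right];
  by rewrite (subset_trans _ h1) // (subset_trans _ h2).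
Qed.

Lemma exists_set_between (T : finType) (A D : {set T}) (r : nat) :
  A \subset D -> (#|A| <= r)%N -> (r <= #|D|)%N ->
  exists B : {set T}, [/\ A \subset B, B \subset D & #|B| = r].
Proof.
move=> AD Ar rD.
have : (0 < #|[set B : {set T} | B \subset D :\: A & #|B| == (r - #|A|)%N]|)%N.
  by rewrite cards_draws bin_gt0 cardsDS // leq_sub2r.
case/card_gt0P=> B; rewrite inE subsetD => /andP[/andP[BD dBA] /eqP cB].
exists (A :|: B); split; rewrite ?subsetUl ?subUset ?AD ?BD //.
rewrite cardsU disjoint_setI0 1?disjoint_sym // cards0 cB; lia.
Qed.

(** Small coalitions can be enlarged to size exactly [r] while staying disjoint,
    since there are at least [2 * r] users. *)
Lemma separating_family_le (T : finType) (r : nat) (s : seq {set T})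
    (C1 C2 : {set T}) :
  (2 * r <= #|T|)%N -> separating_family r s ->
  (#|C1| <= r)%N -> (#|C2| <= r)%N -> [disjoint C1 & C2] ->
  exists2 A, A \in s & separates A C1 C2.
Proof.
move=> rT sep c1 c2 dC.
have [||D1 [s1 d1 e1]] := @exists_set_between T C1 (~: C2) r _ c1.
- by rewrite -disjoints_subset.
- have := cardsC C2; lia.
have [||D2 [s2 d2 e2]] := @exists_set_between T C2 (~: D1) r _ c2.
- by rewrite -disjoints_subset disjoint_sym disjoints_subset.
- have := cardsC D1; lia.
have [|A As sA] := sep D1 D2 e1 e2.
  by rewrite disjoint_sym disjoints_subset.
by exists A => //; exact: separates_sub s1 s2 sA.
Qed.

Definition incidence_word (T : finType) (s : seq {set T}) (x : T) :
    word (size s) :=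
  [ffun i => x \in tnth (in_tuple s) i].

Lemma incidence_word_inj (T : finType) (r : nat) (s : seq {set T}) :
  (0 < r)%N -> (2 * r <= #|T|)%N -> separating_family r s ->
  injective (incidence_word s).
Proof.
move=> r0 rT sep x y exy; apply/eqP/negP => /negP nxy.
have [|||A /(tnthP (in_tuple s))[i ->] sA] :=
  @separating_family_le T r s [set x] [set y] rT sep.
- by rewrite cards1.
- by rewrite cards1.
- by rewrite disjoints1 inE.
have := separates_mem sA (set11 x) (set11 y).
move/ffunP: exy => /(_ i); rewrite !ffunE => ->.
by case: (_ \in _).
Qed.

(** A word feasible for both coalitions would have to take two opposite values
    at the coordinate of a bipartition that separates them. *)
Lemma separating_family_SFPC (T : finType) (r : nat) (s : seq {set T}) :
  (0 < r)%N -> (2 * r <= #|T|)%N -> separating_family r s ->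
  SFPC r (size s) #|T| (incidence_word s @: setT).
Proof.
move=> r0 rT sep; have inj := incidence_word_inj r0 rT sep.
split; first by rewrite card_imset // cardsT.
move=> C1 C2 /set0Pn[w1 w1C] /set0Pn[w2 w2C] s1 s2 c1 c2 dC.
have pre (C : {set word (size s)}) : C \subset incidence_word s @: setT ->
    #|incidence_word s @^-1: C| = #|C|.
  move=> sC; rewrite -(card_imset _ inj); congr #|pred_of_set _|.
  apply/setP=> w; apply/imsetP/idP => [[x]|wC]; first by rewrite inE => ? ->.
  by have /imsetP[x _ ew] := subsetP sC w wC; exists x; rewrite // inE -ew.
have [|||A /(tnthP (in_tuple s))[i ->] sA] := @separating_family_le T r s
    (incidence_word s @^-1: C1) (incidence_word s @^-1: C2) rT sep.
- by rewrite pre.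
- by rewrite pre.
- by rewrite -setI_eq0 -preimsetI dC preimset0.
(* as both coalitions are nonempty, this forces coordinate [i] to be constant
   on each of them *)
have cst (x y : T) : incidence_word s x \in C1 -> incidence_word s y \in C2 ->
    incidence_word s x i = ~~ incidence_word s y i.
  move=> xC yC; rewrite !ffunE.
  by apply: separates_mem sA _ _; rewrite inE.
have [/imsetP[x _ ex] /imsetP[y _ ey]] := (subsetP s1 _ w1C, subsetP s2 _ w2C).
have u1 : i \in undetectable C1.
  rewrite inE; apply/forall_inP => u uC; apply/forall_inP => u' u'C.
  have [/imsetP[z _ ez] /imsetP[z' _ ez']] :=
    (subsetP s1 _ uC, subsetP s1 _ u'C).
  by subst; rewrite (cst z y) // (cst z' y).
have u2 : i \in undetectable C2.
  rewrite inE; apply/forall_inP => u uC; apply/forall_inP => u' u'C.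
  have [/imsetP[z _ ez] /imsetP[z' _ ez']] :=
    (subsetP s2 _ uC, subsetP s2 _ u'C).
  by subst; apply/eqP/negb_inj; rewrite -(cst x z) // -(cst x z').
apply/eqP; rewrite -subset0; apply/subsetP => f; rewrite !inE.
case/andP=> /forall_inP/(_ _ w1C)/forall_inP/(_ _ u1)/eqP f1.
move=> /forall_inP/(_ _ w2C)/forall_inP/(_ _ u2)/eqP f2.
have := cst x y; rewrite -ex -ey => /(_ w1C w2C); rewrite -f1 -f2.
by case: (f i).
Qed.

(** * Counting separated pairs *)

(** The pairs are unordered: with ordered ones a set would separate twice as
    many, and the logarithm in the bound would grow by [ln 2]. *)
Definition separated_pairs (T : finType) (r : nat) (A : {set T}) :
    {set {set {set T}}} :=
  [set [set C.1; C.2] | C in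
    setX [set C : {set T} | C \subset A & #|C| == r]
         [set C : {set T} | C \subset ~: A & #|C| == r]].

Lemma card_separated_pairs_le (T : finType) (r : nat) (A : {set T}) :
  (#|separated_pairs r A| <= 'C(#|A|, r) * 'C(#|T| - #|A|, r))%N.
Proof.
rewrite (leq_trans (leq_imset_card _ _)) // cardsX !cards_draws.
by have := cardsC A => <-; rewrite addKn.
Qed.

Lemma mem_separated_pairs (T : finType) (r : nat) (A C1 C2 : {set T}) :
  #|C1| = r -> #|C2| = r -> separates A C1 C2 ->
  [set C1; C2] \in separated_pairs r A.
Proof.
move=> c1 c2 /orP[]/andP[s1 s2]; apply/imsetP.
  by exists (C1, C2); rewrite //= !inE /= s1 s2 c1 c2 eqxx.
by exists (C2, C1); rewrite 1?setUC //= !inE /= s1 s2 c1 c2 eqxx.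
Qed.

Lemma separated_pairs_separates (T : finType) (r : nat) (A C1 C2 : {set T}) :
  [set C1; C2] \in separated_pairs r A -> separates A C1 C2.
Proof.
case/imsetP=> -[D1 D2]; rewrite !inE /= => /andP[/andP[s1 _] /andP[s2 _]] e.
have : C1 \in [set D1; D2] by rewrite -e set21.
have : C2 \in [set D1; D2] by rewrite -e set22.
have : D1 \in [set C1; C2] by rewrite e set21.
have : D2 \in [set C1; C2] by rewrite e set22.
rewrite !inE /separates.
by do 4![case/orP=> /eqP ?]; subst; rewrite ?s1 ?s2 ?orbT.
Qed.

(** These sets [A] are the unions of [C1] with [m - #|C1|] of the points outside
    both [C1] and [C2]. *)
Lemma card_sets_between (T : finType) (m : nat) (C1 C2 : {set T}) :
  [disjoint C1 & C2] -> (#|C1| <= m)%N ->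
  ('C(#|T| - (#|C1| + #|C2|), m - #|C1|) <=
   #|[set A : {set T} | [&& #|A| == m, C1 \subset A & C2 \subset ~: A]]|)%N.
Proof.
move=> dC c1m.
have cU : #|C1 :|: C2| = (#|C1| + #|C2|)%N.
  by rewrite cardsU disjoint_setI0 // cards0 subn0.
have <- : #|~: (C1 :|: C2)| = (#|T| - (#|C1| + #|C2|))%N.
  by rewrite cardsCs setCK cU.
rewrite -cards_draws.
rewrite -(card_in_imset (f := setU C1)) => [|B B'].
  apply/subset_leq_card/subsetP => A /imsetP[B].
  rewrite inE setCU subsetI => /andP[/andP[BC1 BC2] /eqP cB] ->.
  rewrite inE subsetUl setCU subsetI.
  rewrite -[C2 \subset ~: C1]disjoints_subset disjoint_sym dC.
  rewrite -[C2 \subset ~: B]disjoints_subset disjoint_sym disjoints_subset BC2.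
  rewrite cardsU disjoint_setI0 1?disjoint_sym ?disjoints_subset // cards0 cB.
  by rewrite subn0 subnKC ?eqxx.
rewrite !inE !setCU !subsetI => /andP[/andP[b _] _] /andP[/andP[b' _] _].
move=> /(congr1 (fun X => X :\: C1)).
by rewrite !setDUl setDv !set0U !setDE (setIidPl b) (setIidPl b').
Qed.

(** The two orientations of the pair contribute disjoint families of sets [A],
    because [C1] is nonempty. *)
Lemma separating_sets_lower_bound (T : finType) (r m : nat) (C1 C2 : {set T}) :
  (0 < r)%N -> (r <= m)%N -> #|C1| = r -> #|C2| = r -> [disjoint C1 & C2] ->
  (2 * 'C(#|T| - 2 * r, m - r) <=
   #|[set A : {set T} | (#|A| == m) && separates A C1 C2]|)%N.
Proof.
move=> r0 rm c1 c2 dC.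
pose S (D1 D2 : {set T}) :=
  [set A : {set T} | [&& #|A| == m, D1 \subset A & D2 \subset ~: A]].
have le12 := @card_sets_between T m C1 C2 dC ltac:(by rewrite c1).
have le21 := @card_sets_between T m C2 C1 ltac:(by rewrite disjoint_sym)
  ltac:(by rewrite c2).
have -> : [set A : {set T} | (#|A| == m) && separates A C1 C2] =
    S C1 C2 :|: S C2 C1.
  by apply/setP => A; rewrite !inE -andb_orr.
have [x xC] : exists x, x \in C1 by apply/card_gt0P; rewrite c1.
have dS : S C1 C2 :&: S C2 C1 = set0.
  apply/setP => A; rewrite !inE.
  apply/negP => /andP[/and3P[_ /subsetP s _] /and3P[_ _ /subsetP s']].
  by move: (s' x xC); rewrite inE s.
rewrite cardsU dS cards0 subn0 mul2n -addnn.
by move: le12 le21; rewrite c1 c2 addnn -mul2n => le12 le21; exact: leq_add.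
Qed.

Theorem theorem6 (R : realType) (r : nat) (hr : (0 < r)%N) :
  exists t0 : nat, forall t : nat, (t0 <= t)%N ->
    exists (v : nat) (G : {set word v}),
      SFPC r v t G /\
      v%:R <= 'C(t, uphalf t)%:R / (2 * 'C(t - 2 * r, uphalf t - r)%N%:R)
              * (1 + ln ('C(uphalf t, r) * 'C(t./2, r))%N%:R) :> R.
Proof.
(* two disjoint sets of [r] users must exist *)
exists (2 * r)%N => t rt.
set m := uphalf t.
have tE : (t./2 = t - m)%N.
  by rewrite /m uphalf_half; have := odd_double_half t; lia.
have rm : (r <= m)%N by rewrite /m; lia.
pose E := [set A : {set 'I_t} | #|A| == m].
pose U := [set [set C.1; C.2] | C in
  [set C : {set 'I_t} * {set 'I_t} |
    [&& #|C.1| == r, #|C.2| == r & [disjoint C.1 & C.2]]]].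
have degU p : p \in U -> (2 * 'C(t - 2 * r, m - r) <=
    #|[set A in E | p \in separated_pairs r A]|)%N.
  case/imsetP=> -[C1 C2]; rewrite inE /= => /and3P[/eqP c1 /eqP c2 dC] ->.
  have := separating_sets_lower_bound hr rm c1 c2 dC; rewrite card_ord.
  move=> /leq_trans; apply; apply/subset_leq_card/subsetP => A.
  rewrite !inE => /andP[-> sA]; exact: mem_separated_pairs.
have cardF A : A \in E ->
    (#|separated_pairs r A| <= 'C(m, r) * 'C(t./2, r))%N.
  rewrite inE => /eqP cA.
  by have := card_separated_pairs_le r A; rewrite cA card_ord tE.
have [|s [_ sU ks]] := @Stein_Lovasz R _ _ E (@separated_pairs _ r) U _ _
    _ degU cardF.
  by rewrite muln_gt0 bin_gt0 /=; lia.
exists (size s), (incidence_word s @: setT); split.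
  rewrite -[X in SFPC r _ X]card_ord; apply: separating_family_SFPC => //.
    by rewrite card_ord.
  move=> C1 C2 c1 c2 dC; have [|A As sA] := sU [set C1; C2].
    by apply/imsetP; exists (C1, C2); rewrite // inE /= c1 c2 eqxx.
  by exists A => //; exact: separated_pairs_separates sA.
by move: ks; rewrite natrM card_draws card_ord.
Qed.
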